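(* Let $L$ be a finite-dimensional Lie algebra over $\mathbb{F}$. Then $L/NP(L)$, the factor algebra of $L$ by its near perfect radical $NP(L)$, is nilpotent.
   Context: $\mathbb{F}$ denotes either the field of real numbers or the field of complex numbers. An ideal $I$ of $L$ is called a near perfect ideal of $L$ if $[L,I]=I$, where $[L,I]$ is the linear span of all $[x,y]$ with $x\in L$, $y\in I$; the zero ideal is near perfect. The sum of two near perfect ideals is near perfect, so a finite-dimensional Lie algebra $L$ has a largest near perfect ideal (one containing all near perfect ideals of $L$); it is called the near perfect radical of $L$ and denoted $NP(L)$. A Lie algebra $M$ is nilpotent if its lower central series $M^0=M$, $M^{k+1}=[M,M^k]$ satisfies $M^m=0$ for some $m$. *)

(* Defs.v *)
From HB Require Import structures.
From mathcomp Require Import all_boot all_order all_algebra.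
From mathcomp Require Import generic_quotient ring_quotient.
From mathcomp Require Import boolp reals.
From mathcomp Require Import complex.

Set Implicit Arguments.
Unset Strict Implicit.
Unset Printing Implicit Defensive.

Import GRing.Theory VectorInternalTheory.
Local Open Scope ring_scope.
Local Open Scope quotient_scope.

Variant scalars := RealScalars | ComplexScalars.

Definition scalar_field (R : realType) (k : scalars) : fieldType :=
  match k with
  | RealScalars => R
  | ComplexScalars => R[i]
  end.

HB.mixin Record Lmodule_hasLieBracket (F : fieldType) (L : Type)
    of GRing.Lmodule F L := {
  lie : L -> L -> L;
  lie_linearl : forall (a : F) (x y z : L),
    lie (a *: x + y) z = a *: lie x z + lie y z;
  lie_linearr : forall (a : F) (x y z : L),
    lie x (a *: y + z) = a *: lie x y + lie x z;
  liexx : forall x : L, lie x x = 0;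
  lie_jacobi : forall x y z : L,
    lie x (lie y z) + lie y (lie z x) + lie z (lie x y) = 0
}.

#[short(type="lieAlgType")]
HB.structure Definition LieAlgebra (F : fieldType) :=
  { L of Lmodule_hasLieBracket F L & GRing.Lmodule F L }.

#[short(type="finDimLieAlgType")]
HB.structure Definition FinDimLieAlgebra (F : fieldType) :=
  { L of LieAlgebra F L & Vector F L }.

Reserved Notation "[ 'lie' x , y ]" (format "[ 'lie'  x ,  y ]").
Notation "[ 'lie' x , y ]" := (lie x y) : ring_scope.

Section LieTheory.
Variables (F : fieldType) (L : lieAlgType F).
Implicit Types x y z : L.

Lemma lieDl x y z : [lie x + y, z] = [lie x, z] + [lie y, z].
Proof. by have := lie_linearl 1 x y z; rewrite !scale1r. Qed.

Lemma lieDr x y z : [lie x, y + z] = [lie x, y] + [lie x, z].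
Proof. by have := lie_linearr 1 x y z; rewrite !scale1r. Qed.

Lemma lie0x x : [lie 0, x] = 0.
Proof. by apply: (addrI [lie 0, x]); rewrite -lieDl !addr0. Qed.

Lemma liex0 x : [lie x, 0] = 0.
Proof. by apply: (addrI [lie x, 0]); rewrite -lieDr !addr0. Qed.

Lemma lieZl a x y : [lie a *: x, y] = a *: [lie x, y].
Proof. by have := lie_linearl a x 0 y; rewrite lie0x !addr0. Qed.

Lemma lieZr a x y : [lie x, a *: y] = a *: [lie x, y].
Proof. by have := lie_linearr a x y 0; rewrite liex0 !addr0. Qed.

Lemma lieNl x y : [lie - x, y] = - [lie x, y].
Proof. by rewrite -scaleN1r lieZl scaleN1r. Qed.

Lemma lieNr x y : [lie x, - y] = - [lie x, y].
Proof. by rewrite -scaleN1r lieZr scaleN1r. Qed.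

Lemma lieC x y : [lie x, y] = - [lie y, x].
Proof.
apply/eqP; rewrite -addr_eq0; apply/eqP.
by have := liexx (x + y); rewrite lieDl !lieDr !liexx add0r addr0.
Qed.

Lemma lie_suml I r (P : pred I) (E : I -> L) y :
  [lie \sum_(i <- r | P i) E i, y] = \sum_(i <- r | P i) [lie E i, y].
Proof.
by apply: (big_morph (fun x => lie x y)) => [? ?|]; rewrite (lieDl, lie0x).
Qed.

Lemma lie_sumr I r (P : pred I) (E : I -> L) x :
  [lie x, \sum_(i <- r | P i) E i] = \sum_(i <- r | P i) [lie x, E i].
Proof.
by apply: (big_morph (fun y => lie x y)) => [? ?|]; rewrite (lieDr, liex0).
Qed.

End LieTheory.

Section FinDim.
Variables (F : fieldType) (L : finDimLieAlgType F).
Implicit Types U V W I : {vspace L}.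

(* The span of all brackets [lie u, v] with u \in U and v \in V; brackets of *)
(* basis vectors suffice by bilinearity, see mem_lie_prod and lie_prodP.     *)
Definition lie_prod U V : {vspace L} :=
  <<[seq [lie u, v] | u <- vbasis U, v <- vbasis V]>>%VS.

Lemma mem_lie_prod U V u v : u \in U -> v \in V -> [lie u, v] \in lie_prod U V.
Proof.
move=> /coord_vbasis-> /coord_vbasis->.
rewrite lie_suml rpred_sum // => i _; rewrite lie_sumr rpred_sum // => j _.
rewrite lieZl lieZr !rpredZ // memv_span //; apply/allpairsP.
by exists ((vbasis U)`_i, (vbasis V)`_j); rewrite !mem_nth ?size_tuple.
Qed.

Lemma lie_prodP U V W :
  reflect (forall u v, u \in U -> v \in V -> [lie u, v] \in W)
          (lie_prod U V <= W)%VS.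
Proof.
apply: (iffP idP) => [/subvP sUVW u v uU vV | sUVW].
  exact/sUVW/mem_lie_prod.
apply/span_subvP => _ /allpairsP[[u v] /= [uU vV ->]].
by apply: sUVW; exact: vbasis_mem.
Qed.

Lemma lie_prodS U1 U2 V1 V2 :
  (U1 <= U2)%VS -> (V1 <= V2)%VS -> (lie_prod U1 V1 <= lie_prod U2 V2)%VS.
Proof.
move=> /subvP sU /subvP sV; apply/lie_prodP => u v uU vV.
by apply: mem_lie_prod; [exact: sU | exact: sV].
Qed.

Lemma lie_prodDr U V W :
  lie_prod U (V + W) = (lie_prod U V + lie_prod U W)%VS.
Proof.
apply/eqP; rewrite eqEsubv; apply/andP; split; last first.
  by rewrite subv_add !lie_prodS ?addvSl ?addvSr.
apply/lie_prodP => u _ uU /memv_addP[v vV [w wW ->]].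
by rewrite lieDr memv_add // mem_lie_prod.
Qed.

Definition is_lie_ideal I : Prop :=
  forall x y : L, y \in I -> [lie x, y] \in I.

Record lie_ideal := LieIdeal {
  lie_ideal_vspace :> {vspace L};
  lie_idealP : is_lie_ideal lie_ideal_vspace
}.

Definition near_perfect I : Prop := is_lie_ideal I /\ lie_prod fullv I = I.

Lemma near_perfect0 : near_perfect 0%VS.
Proof.
have id0 : is_lie_ideal 0%VS by move=> x y /[!memv0]/eqP->; rewrite liex0.
split=> //; apply/eqP; rewrite -subv0.
by apply/lie_prodP => x y _; exact: id0.
Qed.

Lemma near_perfectD I J :
  near_perfect I -> near_perfect J -> near_perfect (I + J)%VS.
Proof.
move=> [idI LI] [idJ LJ]; split; last by rewrite lie_prodDr LI LJ.
move=> x _ /memv_addP[y yI [z zJ ->]].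
by rewrite lieDr memv_add ?idI ?idJ.
Qed.

Definition largest_near_perfect N : Prop :=
  near_perfect N /\ forall I, near_perfect I -> (I <= N)%VS.

Lemma largest_near_perfect_exists : exists N, largest_near_perfect N.
Proof.
pose P n := `[< exists2 I : {vspace L}, near_perfect I & \dim I = n >].
have exP : exists n, P n.
  by exists 0%N; apply/asboolP; exists 0%VS; [exact: near_perfect0 | exact: dimv0].
have leP n : P n -> (n <= \dim (fullv : {vspace L}))%N.
  by move=> /asboolP[I _ <-]; exact/dimvS/subvf.
case: (ex_maxnP exP leP) => _ /asboolP[N npN <-] maxN.
exists N; split=> // I npI.
have /eqP-> : N == (N + I)%VS.
  rewrite eqEdim addvSl maxN //; apply/asboolP.
  by exists (N + I)%VS => //; exact: near_perfectD.
exact: addvSr.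
Qed.

Lemma largest_near_perfect_unique M N :
  largest_near_perfect M -> largest_near_perfect N -> M = N.
Proof.
by move=> [npM maxM] [npN maxN]; apply/eqP; rewrite eqEsubv maxN ?maxM.
Qed.

Definition near_perfect_radical_vspace : {vspace L} :=
  projT1 (cid largest_near_perfect_exists).

Lemma near_perfect_radicalP : largest_near_perfect near_perfect_radical_vspace.
Proof. exact: projT2 (cid largest_near_perfect_exists). Qed.

Definition near_perfect_radical : lie_ideal :=
  LieIdeal near_perfect_radicalP.1.1.

Fixpoint lower_central k : {vspace L} :=
  if k is k'.+1 then lie_prod fullv (lower_central k') else fullv.

Definition lie_nilpotent : Prop := exists m, lower_central m = 0%VS.

End FinDim.

Arguments lie_nilpotent {F} L.
Arguments near_perfect_radical {F} L.

Section Quotient.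
Variables (F : fieldType) (L : finDimLieAlgType F) (I : lie_ideal L).

Definition lie_quot : Type :=
  {ideal_quot (pred_of_vspace I : zmodClosed L)}.

HB.instance Definition _ := GRing.Zmodule.on lie_quot.

Definition lie_quot_pi (x : L) : lie_quot := \pi_(Quotient.quot _) x.
Definition lie_quot_repr (q : lie_quot) : L :=
  repr (q : Quotient.quot (pred_of_vspace I : zmodClosed L)).
Local Notation pi := lie_quot_pi.
Local Notation rep := lie_quot_repr.

Lemma lie_quot_reprK : cancel rep pi.
Proof. by move=> q; rewrite /pi /rep reprK. Qed.

Lemma lie_quot_piE (x y : L) : (pi x == pi y) = (x - y \in I).
Proof. by rewrite /pi -Quotient.idealrBE. Qed.

Lemma lie_quot_piP (x y : L) : reflect (pi x = pi y) (x - y \in I).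
Proof. by rewrite -lie_quot_piE; exact: eqP. Qed.

Lemma lie_quot_repr_pi (x : L) : rep (pi x) - x \in I.
Proof. by apply/lie_quot_piP; rewrite lie_quot_reprK. Qed.

Lemma lie_quot_piD (x y : L) : pi (x + y) = pi x + pi y.
Proof. exact: raddfD. Qed.

Lemma lie_quot_pi0 : pi 0 = 0.
Proof. exact: raddf0. Qed.

Definition lie_quot_scale (a : F) (q : lie_quot) : lie_quot := pi (a *: rep q).

Lemma lie_quot_scaleE a x : lie_quot_scale a (pi x) = pi (a *: x).
Proof.
by apply/lie_quot_piP; rewrite -scalerBr rpredZ // lie_quot_repr_pi.
Qed.

Fact lie_quot_scaleA a b q :
  lie_quot_scale a (lie_quot_scale b q) = lie_quot_scale (a * b) q.
Proof. by rewrite -[q]lie_quot_reprK !lie_quot_scaleE scalerA. Qed.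

Fact lie_quot_scale1 : left_id 1 lie_quot_scale.
Proof. by move=> q; rewrite -[q]lie_quot_reprK !lie_quot_scaleE scale1r. Qed.

Fact lie_quot_scaleDr : right_distributive lie_quot_scale +%R.
Proof.
move=> a q r; rewrite -[q]lie_quot_reprK -[r]lie_quot_reprK -lie_quot_piD.
by rewrite !lie_quot_scaleE scalerDr lie_quot_piD.
Qed.

Fact lie_quot_scaleDl q : {morph lie_quot_scale^~ q : a b / a + b}.
Proof.
move=> a b; rewrite -[q]lie_quot_reprK.
by rewrite !lie_quot_scaleE scalerDl lie_quot_piD.
Qed.

HB.instance Definition _ := GRing.Zmodule_isLmodule.Build F lie_quot
  lie_quot_scaleA lie_quot_scale1 lie_quot_scaleDr lie_quot_scaleDl.

Lemma lie_quot_piZ a (x : L) : pi (a *: x) = a *: pi x.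
Proof. exact/esym/lie_quot_scaleE. Qed.

(* Coordinates on L / I: the projection of a representative to a complement  *)
(* of I along I does not depend on the representative.                       *)
Fact lie_quot_vect_iso : Vector.axiom (\dim I^C) lie_quot.
Proof.
pose p := daddv_pi I^C I.
have dIC : (I^C :&: I = 0)%VS by rewrite capvC capv_compl.
have xV x : x \in (I^C + I)%VS by rewrite addvC addv_complf memvf.
have pE x y : x - y \in I -> p x = p y.
  move=> xyI; apply/eqP; rewrite -subr_eq0 -linearB /=; apply/eqP.
  apply: (addIr (x - y)); rewrite add0r -{3}(daddv_pi_add dIC (xV (x - y))).
  by rewrite (daddv_pi_id (capv_compl I)).
have pI x : pi (p x) = pi x.
  apply/esym/lie_quot_piP.
  rewrite -{1}(daddv_pi_add dIC (xV x)) addrAC subrr add0r.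
  exact: memv_pi.
pose f (q : lie_quot) : 'rV[F]_(\dim I^C) := v2r (vsproj I^C (p (rep q))).
pose g (v : 'rV[F]_(\dim I^C)) : lie_quot := pi (vsval (@r2v F (subvs_of I^C) v)).
exists f.
  move=> a q r; apply: etrans (linearP (@v2r F (subvs_of I^C)) _ _ _).
  congr v2r; rewrite -linearP; congr (vsproj _ _); rewrite -linearP.
  apply: pE; apply/lie_quot_piP.
  by rewrite lie_quot_piD lie_quot_piZ !lie_quot_reprK.
exists g => [q|v].
  by rewrite /g /f v2rK vsprojK ?memv_pi // pI lie_quot_reprK.
rewrite /f /g (pE _ _ (lie_quot_repr_pi _)) daddv_pi_id ?subvsP //.
by rewrite vsvalK r2vK.
Qed.

HB.instance Definition _ :=
  Lmodule_hasFinDim.Build F lie_quot lie_quot_vect_iso.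

Definition lie_quot_lie (q r : lie_quot) : lie_quot := pi [lie rep q, rep r].

Lemma lie_quot_lieE x y : lie_quot_lie (pi x) (pi y) = pi [lie x, y].
Proof.
apply/lie_quot_piP.
set x' := rep _; set y' := rep _.
have -> : [lie x', y'] - [lie x, y] = [lie x', y' - y] - [lie y, x' - x].
  rewrite !lieDr !lieNr [[lie y, x']]lieC [[lie y, x]]lieC.
  by rewrite !opprK opprD opprK addrA addrNK.
by rewrite rpredB // (lie_idealP (l := I)) // lie_quot_repr_pi.
Qed.

Fact lie_quot_linearl a q r s :
  lie_quot_lie (a *: q + r) s = a *: lie_quot_lie q s + lie_quot_lie r s.
Proof.
rewrite -[q]lie_quot_reprK -[r]lie_quot_reprK -[s]lie_quot_reprK.
by rewrite -lie_quot_piZ -lie_quot_piD !lie_quot_lieE lie_linearl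
   lie_quot_piD lie_quot_piZ.
Qed.

Fact lie_quot_linearr a q r s :
  lie_quot_lie q (a *: r + s) = a *: lie_quot_lie q r + lie_quot_lie q s.
Proof.
rewrite -[q]lie_quot_reprK -[r]lie_quot_reprK -[s]lie_quot_reprK.
by rewrite -lie_quot_piZ -lie_quot_piD !lie_quot_lieE lie_linearr
   lie_quot_piD lie_quot_piZ.
Qed.

Fact lie_quot_liexx q : lie_quot_lie q q = 0.
Proof. by rewrite -[q]lie_quot_reprK lie_quot_lieE liexx lie_quot_pi0. Qed.

Fact lie_quot_jacobi q r s :
  lie_quot_lie q (lie_quot_lie r s) + lie_quot_lie r (lie_quot_lie s q)
    + lie_quot_lie s (lie_quot_lie q r) = 0.
Proof.
rewrite -[q]lie_quot_reprK -[r]lie_quot_reprK -[s]lie_quot_reprK.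
by rewrite !lie_quot_lieE -!lie_quot_piD lie_jacobi lie_quot_pi0.
Qed.

HB.instance Definition _ := Lmodule_hasLieBracket.Build F lie_quot
  lie_quot_linearl lie_quot_linearr lie_quot_liexx lie_quot_jacobi.

Lemma lie_quot_pi_lie (x y : L) : pi [lie x, y] = [lie pi x, pi y].
Proof. exact/esym/lie_quot_lieE. Qed.

End Quotient.

(* Main.v *)
From HB Require Import structures.
Require Import Defs.
From mathcomp Require Import all_boot all_order all_algebra reals.

(** The lower central series of [L] is a decreasing sequence of ideals, so by
    finite dimension it stops: [L^(m+1) = L^m] for some [m].  This equation
    says that the ideal [L^m] is near perfect ([lower_central_stationary]), so
    [L^m] lies in [NP(L)].  The projection onto [L / NP(L)] is a morphism of
    Lie algebras, hence it maps [L^m] onto the [m]-th term of the series of the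
    quotient ([lower_central_quot]), and that term vanishes. *)

Import GRing.Theory.
Local Open Scope ring_scope.

Section LowerCentral.
Context {F : fieldType} {L : finDimLieAlgType F}.

Lemma lower_central_ideal m : is_lie_ideal (lower_central L m).
Proof.
elim: m => [|m IHm] x y Hy; first exact: memvf.
apply: mem_lie_prod; first exact: memvf.
move: Hy; apply/subvP/lie_prodP => u v _; exact: IHm.
Qed.

Lemma lower_centralS m : (lower_central L m.+1 <= lower_central L m)%VS.
Proof. by apply/lie_prodP => u v _; exact: lower_central_ideal. Qed.

(** Each term is strictly smaller than the preceding one until the series
    stops, so its dimension cannot drop more than [\dim L] times. *)
Lemma lower_central_stationary : exists m, near_perfect (lower_central L m).
Proof.
have [m eqm] : exists m, lower_central L m.+1 = lower_central L m.
  have: exists n, exists m, \dim (lower_central L m) = n by exists (\dim (lower_central L 0)), 0%N.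
  case=> n; elim/ltn_ind: n => n IHn [m dimm].
  have [|neqm] := eqVneq (lower_central L m.+1) (lower_central L m).
    by exists m.
  apply: (IHn (\dim (lower_central L m.+1))); last by exists m.+1.
  rewrite -dimm ltnNge; apply: contra neqm => le_dim.
  by rewrite eqEdim lower_centralS.
by exists m; split=> //; exact: lower_central_ideal.
Qed.

End LowerCentral.

Section Projection.
Context {F : fieldType} {L : finDimLieAlgType F} (I : lie_ideal L).

Fact lie_quot_pi_linear : linear (@lie_quot_pi F L I).
Proof. by move=> a x y; rewrite lie_quot_piD lie_quot_piZ. Qed.

HB.instance Definition _ :=
  GRing.isLinear.Build F L (lie_quot I) _ _ lie_quot_pi_linear.

(** The projection preserves brackets and is onto, so it carries
    [[L, L^m]] onto the bracket of the quotient with the image of [L^m]. *)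
Lemma lower_central_quot m :
  lower_central (lie_quot I) m
    = (linfun (@lie_quot_pi F L I) @: lower_central L m)%VS.
Proof.
set pi := linfun _.
have piE x : pi x = lie_quot_pi I x by rewrite lfunE.
have pi_surj q : exists x, q = pi x.
  by exists (lie_quot_repr q); rewrite piE lie_quot_reprK.
elim: m => [|m /= ->]; apply/eqP; rewrite eqEsubv; apply/andP; split.
- apply/subvP => q _; have [x ->] := pi_surj q; exact/memv_img/memvf.
- exact: subvf.
- apply/lie_prodP => q _ _ /memv_imgP[y Ly ->].
  have [x ->] := pi_surj q.
  rewrite !piE -lie_quot_pi_lie -piE memv_img // mem_lie_prod //.
  exact: memvf.
- (* As the preimage of a subspace is a subspace, brackets suffice. *)
  apply/subvP => _ /memv_imgP[x Lx ->]; rewrite memv_preim.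
  move: x Lx; apply/subvP/lie_prodP => u v _ Lv.
  by rewrite -memv_preim piE lie_quot_pi_lie -!piE mem_lie_prod ?memv_img ?memvf.
Qed.

End Projection.

Theorem proposition3p5 (R : realType) (k : scalars)
    (L : finDimLieAlgType (scalar_field R k)) :
  lie_nilpotent (lie_quot (near_perfect_radical L)).
Proof.
have [_ NPmax] := near_perfect_radicalP L.
have [m npm] := @lower_central_stationary _ L.
exists m; rewrite lower_central_quot; apply/eqP; rewrite -subv0.
apply/subvP => _ /memv_imgP[x Lx ->]; rewrite lfunE memv0 /= -lie_quot_pi0.
by rewrite lie_quot_piE subr0; apply: (subvP (NPmax _ npm)).
Qed.
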